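(* (Artin--Rees lemma) Let $R$ be a complete local-filtered ring, and let $M$ be a separated filtered $R$-space. Assume that the associated graded space $\mathrm{gr}(M)$ is a finitely generated $\mathrm{gr}(R)$-module. Then there exists an integer $D\in\mathbb{N}_0$ such that $$F^{n+d}(M)=F^n(R)F^d(M)$$ for all integers $n\in\mathbb{N}_0$ and $d\ge D$.
   Context: Rings are unital and not necessarily associative; ''commutative ring/algebra'' means commutative and associative. $\mathbb{N}_0=\{0,1,2,\dots\}$. An $R$-space is an abelian group $M$ with a bilinear pairing $R\times M\to M$, $(r,m)\mapsto rm$, such that $1m=m$ for all $m\in M$ (no associativity is required). For subsets $A\subseteq R$ and $\Delta\subseteq M$, $A\Delta$ denotes the additive subgroup of all finite sums $\sum ax$ with $a\in A$, $x\in\Delta$ (and similarly for products of subsets of $R$). A filtered ring is a ring $R$ with a decreasing sequence of (two-sided) ideals $F^0(R)\supseteq F^1(R)\supseteq\cdots$ with $F^0(R)=R$ and $F^i(R)F^j(R)\subseteq F^{i+j}(R)$ for all $i,j\ge0$. A filtered $R$-space is an $R$-space $M$ with a decreasing sequence of $R$-subspaces $F^0(M)\supseteq F^1(M)\supseteq\cdots$ with $F^0(M)=M$ and $F^i(R)F^j(M)\subseteq F^{i+j}(M)$ for all $i,j\ge0$. It is separated if $\bigcap_i F^i(M)=0$. A filtration on $A$ is complete if $A\to\varprojlim A/F^i(A)$ is an isomorphism. $\mathrm{gr}(R)=\bigoplus_{i\ge0}F^i(R)/F^{i+1}(R)$ is a graded ring and $\mathrm{gr}(M)=\bigoplus_{i\ge0}F^i(M)/F^{i+1}(M)$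 is a graded $\mathrm{gr}(R)$-space. A complete local-filtered ring is a filtered ring $R$ whose filtration is complete and such that $R/F^1(R)$ is a field and $\mathrm{gr}(R)$ is a finitely generated commutative $R/F^1(R)$-algebra, generated in degree $1$. That $\mathrm{gr}(M)$ is a $\mathrm{gr}(R)$-module means that the $\mathrm{gr}(R)$-space structure on $\mathrm{gr}(M)$ is a module structure in the usual (associative) sense over the commutative ring $\mathrm{gr}(R)$. *)

(* Defs.v *)
From HB Require Import structures.
From mathcomp Require Import all_boot all_algebra.
From mathcomp Require Import all_classical.

Set Implicit Arguments.
Unset Strict Implicit.
Unset Printing Implicit Defensive.

Import GRing.Theory.

Local Open Scope ring_scope.
Local Open Scope quotient_scope.
Local Open Scope classical_set_scope.

Reserved Notation "x ** y" (at level 40, left associativity).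
Reserved Notation "a **: m" (at level 40).

Declare Scope na_scope.
Delimit Scope na_scope with NA.
Local Open Scope na_scope.

(* Unital rings, not necessarily associative; the zero ring is allowed. *)
HB.mixin Record Zmodule_isNaRing R of GRing.Zmodule R := {
  na_one : R;
  na_mul : R -> R -> R;
  na_mul1r : left_id na_one na_mul;
  na_mulr1 : right_id na_one na_mul;
  na_mulDl : left_distributive na_mul +%R;
  na_mulDr : right_distributive na_mul +%R
}.

#[short(type="naRingType")]
HB.structure Definition NaRing := {R of Zmodule_isNaRing R & GRing.Zmodule R}.

Notation "x ** y" := (na_mul x y) : na_scope.

(* R-spaces: no associativity (a ** b) **: m = a **: (b **: m) is required. *)
HB.mixin Record Zmodule_isNaSpace (R : naRingType) M of GRing.Zmodule M := {
  na_scale : R -> M -> M;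
  na_scale1 : left_id (na_one : R) na_scale;
  na_scaleDl : forall m, {morph na_scale^~ m : a b / a + b >-> a + b};
  na_scaleDr : forall a, {morph na_scale a : m n / m + n >-> m + n}
}.

#[short(type="naSpaceType")]
HB.structure Definition NaSpace (R : naRingType) :=
  {M of Zmodule_isNaSpace R M & GRing.Zmodule M}.

Notation "a **: m" := (na_scale a m) : na_scope.

(* For a bilinear [op] and sets A, B: the set of finite sums of op a b with
   a \in A and b \in B (a subgroup as soon as A or B is one). *)
Definition add_prod (U V W : zmodType) (op : U -> V -> W)
    (A : set U) (B : set V) : set W :=
  [set w | exists (n : nat) (a : 'I_n -> U) (b : 'I_n -> V),
    [/\ forall i, A (a i), forall i, B (b i) & w = \sum_(i < n) op (a i) (b i)]].

Definition is_subgroup (M : zmodType) (A : set M) : Prop :=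
  A 0 /\ forall x y, A x -> A y -> A (x - y).

Definition is_ideal (R : naRingType) (I : set R) : Prop :=
  is_subgroup I /\ forall r x, I x -> I (r ** x) /\ I (x ** r).

Definition is_subspace (R : naRingType) (M : naSpaceType R) (N : set M) : Prop :=
  is_subgroup N /\ forall (r : R) x, N x -> N (r **: x).

Record filtration (M : zmodType) := Filtration {
  filt :> nat -> set M;
  filt_subgroup : forall i, is_subgroup (filt i);
  filt_decr : forall i, filt i.+1 `<=` filt i;
  filt_0 : filt 0%N = setT
}.

Record ring_filtration (R : naRingType) := RingFiltration {
  rfilt :> filtration R;
  rfilt_ideal : forall i, is_ideal (rfilt i);
  rfilt_mul : forall i j,
    add_prod na_mul (rfilt i) (rfilt j) `<=` rfilt (i + j)%N
}.

Record space_filtration (R : naRingType) (FR : ring_filtration R)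
    (M : naSpaceType R) := SpaceFiltration {
  sfilt :> filtration M;
  sfilt_subspace : forall i, is_subspace (sfilt i);
  sfilt_scale : forall i j,
    add_prod na_scale (FR i) (sfilt j) `<=` sfilt (i + j)%N
}.

Definition separated (M : zmodType) (F : filtration M) : Prop :=
  \bigcap_i F i = [set 0].

Lemma filt_le (M : zmodType) (F : filtration M) i j :
  (i <= j)%N -> F j `<=` F i.
Proof.
move=> /subnK <-; elim: (j - i)%N => [//|n IHn]; rewrite addSn.
exact: subset_trans (@filt_decr _ F _) IHn.
Qed.

Section Quotients.
Variables (M : zmodType) (F : filtration M).

Definition filt_pred (i : nat) : M -> bool := fun x => x \in F i.

Lemma filt_pred_zmod_closed i : zmod_closed (filt_pred i).
Proof.
have [F0 FB] := filt_subgroup F i.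
split; first by rewrite unfold_in /filt_pred inE.
by move=> x y; rewrite !unfold_in /filt_pred !inE; exact: FB.
Qed.

HB.instance Definition _ i :=
  GRing.isZmodClosed.Build M (filt_pred i) (filt_pred_zmod_closed i).

Lemma filt_predE i x : (x \in filt_pred i) = (x \in F i).
Proof. by []. Qed.

Definition filt_quot (i : nat) :=
  Quotient.quot (GRing.ZmodClosed.clone M (filt_pred i) _).
HB.instance Definition _ i := GRing.Zmodule.on (filt_quot i).
HB.instance Definition _ i := EqQuotient.on (filt_quot i).

Definition filt_sub (i : nat) := {x : M | x \in filt_pred i}.
HB.instance Definition _ i := SubChoice.on (filt_sub i).
HB.instance Definition _ i := [SubChoice_isSubZmodule of filt_sub i by <:].

Definition filt_next (i : nat) : filt_sub i -> bool :=
  fun u => val u \in filt_pred i.+1.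

Lemma filt_next_zmod_closed i : zmod_closed (@filt_next i).
Proof.
split; first by rewrite unfold_in /filt_next raddf0 rpred0.
move=> x y; rewrite !unfold_in /filt_next raddfB.
exact: (@rpredB _ (GRing.ZmodClosed.clone M (filt_pred i.+1) _)).
Qed.

HB.instance Definition _ i :=
  GRing.isZmodClosed.Build (filt_sub i) (@filt_next i)
    (filt_next_zmod_closed i).

(* F^i(M) / F^{i+1}(M) *)
Definition gr_comp (i : nat) :=
  Quotient.quot (GRing.ZmodClosed.clone (filt_sub i) (@filt_next i) _).
HB.instance Definition _ i := GRing.Zmodule.on (gr_comp i).
HB.instance Definition _ i := EqQuotient.on (gr_comp i).

(* The limit of the M / F^i(M) along the projections M / F^j -> M / F^i. *)
Definition filt_proj (i j : nat) (q : filt_quot j) : filt_quot i :=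
  \pi_(filt_quot i) (repr q).

Record inverse_limit := InverseLimit {
  invlim_seq :> forall i, filt_quot i;
  invlim_compat : forall i j, (i <= j)%N ->
    filt_proj i (invlim_seq j) = invlim_seq i
}.

Lemma filt_quot_eqP i x y :
  \pi_(filt_quot i) x = \pi_(filt_quot i) y <-> F i (x - y).
Proof.
have -> : F i (x - y) <-> x - y \in filt_pred i by rewrite filt_predE inE.
by rewrite Quotient.idealrBE; split=> /eqP.
Qed.

Lemma filt_projE i j x : (i <= j)%N ->
  filt_proj i (\pi_(filt_quot j) x) = \pi_(filt_quot i) x.
Proof.
move=> le_ij; apply/filt_quot_eqP/(filt_le le_ij)/filt_quot_eqP.
by rewrite reprK.
Qed.

Definition to_inverse_limit (x : M) : inverse_limit :=
  @InverseLimit (fun i => \pi_(filt_quot i) x) (fun i j => @filt_projE i j x).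

Definition complete : Prop := bijective to_inverse_limit.

(* The class of x in F^i(M) / F^{i+1}(M) when x \in F^i(M); the value for other
   x is irrelevant (it is 0). *)
Definition symb (i : nat) (x : M) : gr_comp i :=
  \pi_(gr_comp i) (insubd (0 : filt_sub i) x).

Lemma symb_eqP i x y : F i x -> F i y -> symb i x = symb i y <-> F i.+1 (x - y).
Proof.
move=> Fx Fy; set a := insubd (0 : filt_sub i) x.
set b := insubd (0 : filt_sub i) y.
have -> : F i.+1 (x - y) <-> a - b \in @filt_next i.
  rewrite unfold_in /filt_next raddfB /= !insubdK ?filt_predE ?inE //.
by rewrite Quotient.idealrBE; split=> /eqP.
Qed.

Definition symb_repr (i : nat) (u : gr_comp i) : M := val (repr u).

Lemma symb_reprP i (u : gr_comp i) : F i (symb_repr u).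
Proof. by have := valP (repr u); rewrite filt_predE inE. Qed.

Lemma symb_reprK i (u : gr_comp i) : symb i (symb_repr u) = u.
Proof. by rewrite /symb /symb_repr valKd reprK. Qed.

Lemma symbB i x y : F i x -> F i y -> symb i (x - y) = symb i x - symb i y.
Proof.
move=> Fx Fy; have FB := (filt_subgroup F i).2 x y Fx Fy.
rewrite /symb -raddfB; congr (\pi _); apply/val_inj.
by rewrite raddfB /= !insubdK ?filt_predE ?inE.
Qed.

Lemma symb0 i : symb i 0 = 0.
Proof.
have F0 := (filt_subgroup F i).1.
by rewrite -[0 in LHS](subrr 0) symbB ?subrr.
Qed.

End Quotients.

Arguments symb {M} F i x.
Arguments filt_quot {M} F i.
Arguments gr_comp {M} F i.

Section DirectSum.
Variable G : nat -> zmodType.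

Record dsum := DSum {
  dsum_fun :> forall i, G i;
  dsum_fin : exists n, forall i, (n <= i)%N -> dsum_fun i = 0
}.

HB.instance Definition _ := gen_eqMixin dsum.
HB.instance Definition _ := gen_choiceMixin dsum.

Lemma dsumP (u v : dsum) : (forall i, u i = v i) -> u = v.
Proof.
case: u v => [u hu] [v hv] /= uv; have {}uv := functional_extensionality_dep uv.
by case: v / uv hv => hv; congr DSum; exact: Prop_irrelevance.
Qed.

Definition dsum0 : dsum :=
  @DSum (fun=> 0) (ex_intro _ 0%N (fun _ _ => erefl)).

Lemma dsum_opp_fin (u : dsum) : exists n, forall i, (n <= i)%N -> - u i = 0.
Proof. by have [n un] := dsum_fin u; exists n => i /un ->; rewrite oppr0. Qed.
Definition dsum_opp (u : dsum) : dsum := DSum (dsum_opp_fin u).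

Lemma dsum_add_fin (u v : dsum) :
  exists n, forall i, (n <= i)%N -> u i + v i = 0.
Proof.
have [n un] := dsum_fin u; have [m vm] := dsum_fin v.
by exists (maxn n m) => i; rewrite geq_max => /andP[/un -> /vm ->]; rewrite addr0.
Qed.
Definition dsum_add (u v : dsum) : dsum := DSum (dsum_add_fin u v).

Lemma dsum_addA : associative dsum_add.
Proof. by move=> u v w; apply: dsumP => i /=; rewrite addrA. Qed.
Lemma dsum_addC : commutative dsum_add.
Proof. by move=> u v; apply: dsumP => i /=; rewrite addrC. Qed.
Lemma dsum_add0 : left_id dsum0 dsum_add.
Proof. by move=> u; apply: dsumP => i /=; rewrite add0r. Qed.
Lemma dsum_addN : left_inverse dsum0 dsum_opp dsum_add.
Proof. by move=> u; apply: dsumP => i /=; rewrite addNr. Qed.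

HB.instance Definition _ :=
  GRing.isZmodule.Build dsum dsum_addA dsum_addC dsum_add0 dsum_addN.

Lemma dsumDE (u v : dsum) i : (u + v) i = u i + v i. Proof. by []. Qed.
Lemma dsum0E i : (0 : dsum) i = 0. Proof. by []. Qed.

End DirectSum.

Definition gr (M : zmodType) (F : filtration M) := dsum (gr_comp F).
HB.instance Definition _ (M : zmodType) (F : filtration M) :=
  GRing.Zmodule.on (gr F).

(* The homogeneous element of degree i with component [symb F i x]. *)
Section Homogeneous.
Variables (M : zmodType) (F : filtration M) (i : nat) (x : M).

Lemma gr_homog_fin : exists n, forall k, (n <= k)%N ->
  (if k == i then symb F k x else 0) = 0.
Proof. by exists i.+1 => k; case: eqP => // ->; rewrite ltnn. Qed.

Definition gr_homog : gr F := DSum gr_homog_fin.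

End Homogeneous.

Definition gr_degree (M : zmodType) (F : filtration M) (i : nat) : set (gr F) :=
  [set u : gr F | forall k, k != i -> u k = 0].

(* A biadditive map compatible with filtrations induces a biadditive map on the
   associated graded groups; this gives the product of gr(R) and its action on
   gr(M). *)
Record filtered_pairing (U V W : zmodType) (FU : filtration U)
    (FV : filtration V) (FW : filtration W) (op : U -> V -> W) : Prop := {
  pairDl : forall v, {morph op^~ v : a b / a + b >-> a + b};
  pairDr : forall u, {morph op u : a b / a + b >-> a + b};
  pair_filt : forall i j, add_prod op (FU i) (FV j) `<=` FW (i + j)%N
}.

Section GradedPairing.
Variables (U V W : zmodType).
Variables (FU : filtration U) (FV : filtration V) (FW : filtration W).
Variables (op : U -> V -> W) (pair_op : filtered_pairing FU FV FW op).

Definition gr_comp_mul (i j k : nat) (a : gr_comp FU i) (b : gr_comp FV j) :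
    gr_comp FW k :=
  symb FW k (op (symb_repr a) (symb_repr b)).

Lemma pairBl v : {morph op^~ v : a b / a - b >-> a - b}.
Proof.
by move=> a b /=; apply/eqP; rewrite eq_sym subr_eq -(pairDl pair_op) addrNK.
Qed.

Lemma pairBr u : {morph op u : a b / a - b >-> a - b}.
Proof.
by move=> a b /=; apply/eqP; rewrite eq_sym subr_eq -(pairDr pair_op) addrNK.
Qed.

Lemma pair_mem i j a b : FU i a -> FV j b -> FW (i + j)%N (op a b).
Proof.
move=> Fa Fb; apply: (pair_filt pair_op).
by exists 1%N, (fun=> a), (fun=> b); split=> //; rewrite big_ord1.
Qed.

Lemma gr_comp_mulE i j k a b : (i + j)%N = k -> FU i a -> FV j b ->
  gr_comp_mul k (symb FU i a) (symb FV j b) = symb FW k (op a b).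
Proof.
move=> <- Fa Fb; rewrite /gr_comp_mul.
have Fa' := symb_reprP (symb FU i a); have Fb' := symb_reprP (symb FV j b).
have /symb_eqP : symb FU i (symb_repr (symb FU i a)) = symb FU i a.
  exact: symb_reprK.
have /symb_eqP : symb FV j (symb_repr (symb FV j b)) = symb FV j b.
  exact: symb_reprK.
move=> /(_ Fb' Fb) b'b /(_ Fa' Fa) a'a.
move: (symb_repr _) (symb_repr _) Fa' Fb' a'a b'b => b' a' Fa' Fb' a'a b'b.
apply/symb_eqP; [exact: pair_mem|exact: pair_mem|].
have -> : op a' b' - op a b = op (a' - a) b' - op a (b - b').
  by rewrite pairBl pairBr opprB addrA subrK.
apply: (filt_subgroup FW _).2; first by rewrite -addSn; exact: pair_mem.
rewrite -addnS; apply: pair_mem => //.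
have [F0 FB] := filt_subgroup FV j.+1.
by rewrite -opprB -[- _]add0r; exact: FB.
Qed.

Lemma gr_comp_mulBl i j k (e : (i + j)%N = k) (a a' : gr_comp FU i)
    (b : gr_comp FV j) :
  gr_comp_mul k (a - a') b = gr_comp_mul k a b - gr_comp_mul k a' b.
Proof.
rewrite -[a]symb_reprK -[a']symb_reprK -[b]symb_reprK.
move: (symb_reprP a) (symb_reprP a') (symb_reprP b).
move: (symb_repr a) (symb_repr a') (symb_repr b) => {a a' b} x x' y Fx Fx' Fy.
rewrite -symbB // !(gr_comp_mulE e) // ?pairBl ?symbB //.
- by rewrite -e; exact: pair_mem.
- by rewrite -e; exact: pair_mem.
- exact: (filt_subgroup FU i).2.
Qed.

Lemma gr_comp_mulBr i j k (e : (i + j)%N = k) (a : gr_comp FU i)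
    (b b' : gr_comp FV j) :
  gr_comp_mul k a (b - b') = gr_comp_mul k a b - gr_comp_mul k a b'.
Proof.
rewrite -[a]symb_reprK -[b]symb_reprK -[b']symb_reprK.
move: (symb_reprP a) (symb_reprP b) (symb_reprP b').
move: (symb_repr a) (symb_repr b) (symb_repr b') => {a b b'} x y y' Fx Fy Fy'.
rewrite -symbB // !(gr_comp_mulE e) // ?pairBr ?symbB //.
- by rewrite -e; exact: pair_mem.
- by rewrite -e; exact: pair_mem.
- exact: (filt_subgroup FV j).2.
Qed.

Lemma gr_comp_mul0l i j k (e : (i + j)%N = k) (b : gr_comp FV j) :
  gr_comp_mul k (0 : gr_comp FU i) b = 0.
Proof. by rewrite -[0 in LHS](subrr 0) (gr_comp_mulBl e) subrr. Qed.

Lemma gr_comp_mul0r i j k (e : (i + j)%N = k) (a : gr_comp FU i) :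
  gr_comp_mul k a (0 : gr_comp FV j) = 0.
Proof. by rewrite -[0 in LHS](subrr 0) (gr_comp_mulBr e) subrr. Qed.

Lemma gr_comp_mulDl i j k (e : (i + j)%N = k) (a a' : gr_comp FU i)
    (b : gr_comp FV j) :
  gr_comp_mul k (a + a') b = gr_comp_mul k a b + gr_comp_mul k a' b.
Proof.
by rewrite -[a' in LHS]opprK -[- a']sub0r !(gr_comp_mulBl e) (gr_comp_mul0l e)
           sub0r opprK.
Qed.

Lemma gr_comp_mulDr i j k (e : (i + j)%N = k) (a : gr_comp FU i)
    (b b' : gr_comp FV j) :
  gr_comp_mul k a (b + b') = gr_comp_mul k a b + gr_comp_mul k a b'.
Proof.
by rewrite -[b' in LHS]opprK -[- b']sub0r !(gr_comp_mulBr e) (gr_comp_mul0r e)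
           sub0r opprK.
Qed.

Lemma gr_mul_fin (u : gr FU) (v : gr FV) : exists n, forall k, (n <= k)%N ->
  \sum_(i < k.+1) gr_comp_mul k (u i) (v (k - i)%N) = 0.
Proof.
have [n un] := dsum_fin u; have [m vm] := dsum_fin v.
exists (n + m)%N => k le_k; apply: big1 => i _.
have e : (i + (k - i))%N = k by rewrite subnKC // -ltnS.
have [le_ni|lt_in] := leqP n i; first by rewrite un // gr_comp_mul0l.
rewrite vm ?gr_comp_mul0r // leq_subRL -1?ltnS //.
by rewrite ltnS (leq_trans _ le_k) // leq_add2r ltnW.
Qed.

Definition gr_mul (u : gr FU) (v : gr FV) : gr FW := DSum (gr_mul_fin u v).

Lemma gr_mulDl v : {morph gr_mul^~ v : u u' / u + u' >-> u + u'}.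
Proof.
move=> u u'; apply: dsumP => k /=; rewrite -big_split; apply: eq_bigr => i _ /=.
by rewrite (@gr_comp_mulDl i (k - i)%N) // subnKC // -ltnS.
Qed.

Lemma gr_mulDr u : {morph gr_mul u : v v' / v + v' >-> v + v'}.
Proof.
move=> v v'; apply: dsumP => k /=; rewrite -big_split; apply: eq_bigr => i _ /=.
by rewrite (@gr_comp_mulDr i (k - i)%N) // subnKC // -ltnS.
Qed.

Lemma gr_mul_homogl i x (v : gr FV) k : (i <= k)%N ->
  gr_mul (gr_homog FU i x) v k = gr_comp_mul k (symb FU i x) (v (k - i)%N).
Proof.
move=> le_ik /=; rewrite (bigD1 (inord i : 'I_k.+1)) //= inordK ?ltnS // eqxx.
rewrite big1 ?addr0 // => j; rewrite -val_eqE /= inordK ?ltnS // => /negPf ->.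
by rewrite (@gr_comp_mul0l j (k - j)%N) // subnKC // -ltnS.
Qed.

Lemma gr_mul_homogr j y (u : gr FU) k : (j <= k)%N ->
  gr_mul u (gr_homog FV j y) k = gr_comp_mul k (u (k - j)%N) (symb FV j y).
Proof.
move=> le_jk /=; rewrite (bigD1 (inord (k - j) : 'I_k.+1)) //=.
have lt_kj : (k - j < k.+1)%N by rewrite ltnS leq_subr.
rewrite inordK // subKn // eqxx big1 ?addr0 // => i.
rewrite -val_eqE /= inordK // => ne_i.
have le_ik : (i <= k)%N by rewrite -ltnS.
case: eqP => [e|_]; last by rewrite (@gr_comp_mul0r i (k - i)%N) // subnKC.
by case/eqP: ne_i; rewrite -e subKn.
Qed.

End GradedPairing.

Section GradedRing.
Variables (R : naRingType) (F : ring_filtration R).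

Definition gr_ring := gr F.
HB.instance Definition _ := GRing.Zmodule.on gr_ring.

Lemma ring_pairing : filtered_pairing F F F (@na_mul R).
Proof.
split; [by move=> v a b; exact: na_mulDl | by move=> u a b; exact: na_mulDr |].
exact: rfilt_mul.
Qed.

Definition gr_ring_one : gr_ring := gr_homog F 0 na_one.
Definition gr_ring_mul : gr_ring -> gr_ring -> gr_ring := gr_mul ring_pairing.

Lemma filt_one : F 0%N na_one. Proof. by rewrite filt_0. Qed.

Lemma gr_ring_mul1r : left_id gr_ring_one gr_ring_mul.
Proof.
move=> u; apply: dsumP => k.
rewrite [LHS]gr_mul_homogl // subn0 -[u k]symb_reprK.
have Fuk := symb_reprP (u k).
by rewrite (gr_comp_mulE ring_pairing (add0n k)) ?na_mul1r //; exact: filt_one.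
Qed.

Lemma gr_ring_mulr1 : right_id gr_ring_one gr_ring_mul.
Proof.
move=> u; apply: dsumP => k.
rewrite [LHS]gr_mul_homogr // subn0 -[u k]symb_reprK.
have Fuk := symb_reprP (u k).
by rewrite (gr_comp_mulE ring_pairing (addn0 k)) ?na_mulr1 //; exact: filt_one.
Qed.

Lemma gr_ring_mulDl : left_distributive gr_ring_mul +%R.
Proof. by move=> u u' v; exact: gr_mulDl. Qed.
Lemma gr_ring_mulDr : right_distributive gr_ring_mul +%R.
Proof. by move=> u v v'; exact: gr_mulDr. Qed.

HB.instance Definition _ := Zmodule_isNaRing.Build gr_ring
  gr_ring_mul1r gr_ring_mulr1 gr_ring_mulDl gr_ring_mulDr.

Definition ring_quot (i : nat) := filt_quot F i.
HB.instance Definition _ i := GRing.Zmodule.on (ring_quot i).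

Definition ring_quot_one i : ring_quot i := \pi_(filt_quot F i) na_one.
Definition ring_quot_mul i (a b : ring_quot i) : ring_quot i :=
  \pi_(filt_quot F i) (repr a ** repr b).

Lemma ring_quot_mulE i x y :
  @ring_quot_mul i (\pi_(filt_quot F i) x) (\pi_(filt_quot F i) y) =
  \pi_(filt_quot F i) (x ** y).
Proof.
rewrite /ring_quot_mul.
have /filt_quot_eqP := reprK (\pi_(filt_quot F i) x).
have /filt_quot_eqP := reprK (\pi_(filt_quot F i) y).
move: (repr _) (repr _) => x' y' Fy Fx.
have [[F0 FB] FM] := rfilt_ideal F i.
apply/filt_quot_eqP.
have -> : x' ** y' - x ** y = (x' - x) ** y' - x ** (y - y').
  by rewrite (pairBl ring_pairing) (pairBr ring_pairing) opprB addrA subrK.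
apply: (FB _ _); first by have [] := FM y' _ Fx.
apply: (FM x _ _).1; rewrite -opprB -[- _]add0r; exact: FB.
Qed.

Lemma ring_quot_mul1r i : left_id (ring_quot_one i) (@ring_quot_mul i).
Proof.
by move=> a; rewrite -[a]reprK /ring_quot_one ring_quot_mulE na_mul1r.
Qed.
Lemma ring_quot_mulr1 i : right_id (ring_quot_one i) (@ring_quot_mul i).
Proof.
by move=> a; rewrite -[a]reprK /ring_quot_one ring_quot_mulE na_mulr1.
Qed.
Lemma filt_quot_piD i x y : \pi_(filt_quot F i) (x + y) =
  \pi_(filt_quot F i) x + \pi_(filt_quot F i) y.
Proof. exact: raddfD. Qed.
Lemma ring_quot_mulDl i : left_distributive (@ring_quot_mul i) +%R.
Proof.
move=> a b c; rewrite -[a]reprK -[b]reprK -[c]reprK.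
by rewrite -filt_quot_piD !ring_quot_mulE -filt_quot_piD na_mulDl.
Qed.
Lemma ring_quot_mulDr i : right_distributive (@ring_quot_mul i) +%R.
Proof.
move=> a b c; rewrite -[a]reprK -[b]reprK -[c]reprK.
by rewrite -filt_quot_piD !ring_quot_mulE -filt_quot_piD na_mulDr.
Qed.

HB.instance Definition _ i := Zmodule_isNaRing.Build (ring_quot i)
  (@ring_quot_mul1r i) (@ring_quot_mulr1 i)
  (@ring_quot_mulDl i) (@ring_quot_mulDr i).

(* The inclusion of R / F^1(R) in gr(R) as the component of degree 0, which is
   the structure map of gr(R) as an R / F^1(R)-algebra. *)
Definition gr_incl (a : ring_quot 1) : gr_ring := gr_homog F 0 (repr a).

Lemma gr_inclE x : gr_incl (\pi_(filt_quot F 1) x) = gr_homog F 0 x.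
Proof.
apply: dsumP => k /=; case: eqP => // ->.
apply/symb_eqP; rewrite ?filt_0 //; apply/filt_quot_eqP.
by rewrite reprK.
Qed.

Lemma gr_incl_add : {morph gr_incl : a b / a + b >-> a + b}.
Proof.
move=> a b; rewrite -[a]reprK -[b]reprK -filt_quot_piD !gr_inclE.
apply: dsumP => k /=.
case: eqP => [->|_]; last by rewrite addr0.
set x := repr a; set y := repr b.
have F0 z : F 0%N z by rewrite filt_0.
by rewrite -[y in LHS]opprK symbB // -[- y]sub0r symbB // symb0 sub0r opprK.
Qed.

Lemma gr_incl_one : gr_incl na_one = na_one.
Proof. exact: gr_inclE. Qed.

Lemma gr_incl_mul : {morph gr_incl : a b / a ** b >-> a ** b}.
Proof.
move=> a b; rewrite -[a]reprK -[b]reprK.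
rewrite [X in gr_incl X]ring_quot_mulE !gr_inclE.
apply: dsumP => k; rewrite [RHS]gr_mul_homogl // subn0 /=.
have F0 z : F 0%N z by rewrite filt_0.
case: eqP => [->|_]; first by rewrite (gr_comp_mulE ring_pairing (addn0 0)).
by rewrite (gr_comp_mul0r ring_pairing (add0n k)).
Qed.

End GradedRing.

Section GradedSpace.
Variables (R : naRingType) (FR : ring_filtration R).
Variables (M : naSpaceType R) (FM : space_filtration FR M).

Definition gr_space := gr FM.
HB.instance Definition _ := GRing.Zmodule.on gr_space.

Lemma space_pairing : filtered_pairing FR FM FM (@na_scale R M).
Proof.
split; [exact: na_scaleDl | exact: na_scaleDr | exact: sfilt_scale].
Qed.

Definition gr_scale : gr_ring FR -> gr_space -> gr_space :=
  gr_mul space_pairing.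

Lemma gr_scale1 : left_id (na_one : gr_ring FR) gr_scale.
Proof.
move=> u; apply: dsumP => k.
rewrite [LHS]gr_mul_homogl // subn0 -[u k]symb_reprK.
have Fuk := symb_reprP (u k).
rewrite (gr_comp_mulE space_pairing (add0n k)) ?na_scale1 //.
exact: filt_one.
Qed.

HB.instance Definition _ := Zmodule_isNaSpace.Build (gr_ring FR) gr_space
  gr_scale1 (gr_mulDl space_pairing) (gr_mulDr space_pairing).

End GradedSpace.

Definition is_commutative (R : naRingType) : Prop :=
  commutative (@na_mul R) /\ associative (@na_mul R).

Definition is_field (K : naRingType) : Prop :=
  [/\ is_commutative K, (na_one : K) <> 0
    & forall x : K, x <> 0 -> exists y : K, x ** y = na_one].

(* Subalgebras of A, for A an algebra over K with structure map iota. *)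
Definition is_subalgebra (K A : naRingType) (iota : K -> A) (B : set A) : Prop :=
  [/\ is_subgroup B, forall c, B (iota c) & forall x y, B x -> B y -> B (x ** y)].

Definition generates_algebra (K A : naRingType) (iota : K -> A) (S : set A) :=
  smallest (is_subalgebra iota) S = setT.

Definition finitely_generated_algebra (K A : naRingType) (iota : K -> A) : Prop :=
  exists S : set A, finite_set S /\ generates_algebra iota S.

Definition complete_local_filtered (R : naRingType) (F : ring_filtration R) :
    Prop :=
  [/\ complete F, is_field (ring_quot F 1), is_commutative (gr_ring F),
      finitely_generated_algebra (@gr_incl R F)
    & generates_algebra (@gr_incl R F) (@gr_degree R F 1)].

(* The unit law 1 **: m = m is part of [naSpaceType]. *)
Definition is_module (A : naRingType) (N : naSpaceType A) : Prop :=
  forall (a b : A) (m : N), (a ** b) **: m = a **: (b **: m).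

Definition finitely_generated (A : naRingType) (N : naSpaceType A) : Prop :=
  exists (n : nat) (g : 'I_n -> N),
    forall m : N, exists a : 'I_n -> A, m = \sum_(i < n) a i **: g i.

(* Main.v *)
(* Degree by degree, gr(R)_(n+1) = gr(R)_n gr(R)_1 with gr(R)_1 finitely
   generated over gr(R)_0. Let D bound the degrees of homogeneous generators of
   gr(M). For d >= D, multiplying these generators by products of degree-1
   elements yields finitely many y_j in F^d(M) whose symbols satisfy
   gr(M)_(n+d) = sum_j gr(R)_n [y_j] for all n at once. Hence m in F^(n+d)(M) is
   approximated successively by sum_j a_j y_j with corrections to a_j in F^n(R),
   F^(n+1)(R), ...; these converge as R is complete, and the remainder vanishes
   as M is separated. The associativity of gr(R) and gr(M) is used in the form
   of congruences modulo the next filtration step. *)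
Require Import Defs.
From mathcomp Require Import all_boot all_algebra all_classical.

Set Implicit Arguments.
Unset Strict Implicit.
Unset Printing Implicit Defensive.

Import GRing.Theory.

Local Open Scope ring_scope.
Local Open Scope classical_set_scope.
Local Open Scope na_scope.

(** * Congruences modulo a filtration and convergent series *)

Section Filtration.
Variables (M : zmodType) (F : filtration M).

Lemma filt0 k : F k 0.
Proof. by case: (filt_subgroup F k). Qed.

Lemma filtB k x y : F k x -> F k y -> F k (x - y).
Proof. by case: (filt_subgroup F k) => _; apply. Qed.

Lemma filtN k x : F k x -> F k (- x).
Proof. by move=> Fx; rewrite -sub0r; exact: filtB (filt0 _) Fx. Qed.

Lemma filtD k x y : F k x -> F k y -> F k (x + y).
Proof. by move=> Fx Fy; rewrite -[y]opprK; exact: filtB Fx (filtN Fy). Qed.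

Lemma filt_sum k (I : Type) (r : seq I) (P : pred I) (f : I -> M) :
  (forall i, P i -> F k (f i)) -> F k (\sum_(i <- r | P i) f i).
Proof. by move=> Ff; apply: big_ind Ff; [exact: filt0 | exact: filtD]. Qed.

Lemma filt_sumB k (I : finType) (f g : I -> M) :
  (forall i, F k (f i - g i)) -> F k (\sum_i f i - \sum_i g i).
Proof. by move=> fg; rewrite -sumrB; apply: filt_sum => i _; exact: fg. Qed.

Lemma filtB_trans k x y z : F k (x - y) -> F k (y - z) -> F k (x - z).
Proof. by move=> xy yz; rewrite -(subrKA y); exact: filtD. Qed.

Lemma filtBC k x y : F k (x - y) -> F k (y - x).
Proof. by move=> /filtN; rewrite opprB. Qed.

Lemma symbD k x y : F k x -> F k y -> symb F k (x + y) = symb F k x + symb F k y.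
Proof.
move=> Fx Fy; have F0 := filt0 k.
by rewrite -[y in LHS]opprK -[- y]sub0r !symbB ?symb0 ?sub0r ?opprK //; exact: filtN.
Qed.

Lemma symb_sum k (I : Type) (r : seq I) (f : I -> M) : (forall i, F k (f i)) ->
  symb F k (\sum_(i <- r) f i) = \sum_(i <- r) symb F k (f i).
Proof.
move=> Ff; elim: r => [|i r IHr]; first by rewrite !big_nil symb0.
by rewrite !big_cons -IHr symbD //; exact: filt_sum.
Qed.

(** The partial sums are compatible modulo the filtration, hence form a point of the inverse limit;
    completeness supplies its preimage. *)
Lemma complete_series n (a : nat -> M) : complete F ->
  (forall k, F (n + k)%N (a k)) ->
  exists x, forall k, F (n + k)%N (x - \sum_(l < k) a l).
Proof.
move=> [g _ gK] Fa; pose s k := \sum_(l < k) a l.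
have sB i j : (i <= j)%N -> F (n + i)%N (s j - s i).
  move=> /subnK <-; elim: (j - i)%N => [|m IHm]; first by rewrite subrr; exact: filt0.
  rewrite addSn /s big_ord_recr /= -addrAC; apply: filtD => //.
  by apply: filt_le (Fa _); rewrite leq_add2l leq_addl.
have compat i j (le_ij : (i <= j)%N) :
    filt_proj i (\pi_(filt_quot F j)%qT (s j)) = \pi_(filt_quot F i)%qT (s i).
  rewrite filt_projE //; apply/filt_quot_eqP.
  by apply: filt_le (sB _ _ le_ij); exact: leq_addl.
pose L := InverseLimit compat.
(* Modulo F^(n+k) the limit is known to agree with the partial sum of index n+k; the terms from k on
   already lie in F^(n+k). *)
exists (g L) => k; apply: (@filtB_trans _ _ (s (n + k)%N)).
  by apply/filt_quot_eqP; exact: (congr1 (fun L => invlim_seq L (n + k)) (gK L)).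
by apply: sB; exact: leq_addl.
Qed.

End Filtration.

(** * Products of symbols in associated graded groups *)

Section Pairing.
Variables (U V W : zmodType).
Variables (FU : filtration U) (FV : filtration V) (FW : filtration W).
Variables (op : U -> V -> W) (pair_op : filtered_pairing FU FV FW op).

Lemma pair_mem_eq i j k x y : (i + j)%N = k -> FU i x -> FV j y -> FW k (op x y).
Proof. by move=> <-; exact: pair_mem. Qed.

Lemma gr_mul_homog i j k x y : (i + j)%N = k -> FU i x -> FV j y ->
  gr_mul pair_op (gr_homog FU i x) (gr_homog FV j y) = gr_homog FW k (op x y).
Proof.
move=> <- {k} Fx Fy; apply: dsumP => k; have [le_ik|lt_ki] := leqP i k.
  rewrite gr_mul_homogl //=; have [->|ne_k] := eqVneq k (i + j)%N.
    by rewrite addKn eqxx (gr_comp_mulE pair_op).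
  case: eqP => [e|_]; first by rewrite -e subnKC ?eqxx in ne_k.
  by rewrite (gr_comp_mul0r pair_op (subnKC le_ik)).
rewrite /= ifN ?big1 //; last by rewrite neq_ltn (leq_trans lt_ki) ?leq_addr.
move=> l _; rewrite ifN; last by rewrite neq_ltn (leq_trans (ltn_ord l)).
by rewrite (gr_comp_mul0l pair_op) // subnKC // -ltnS.
Qed.

Lemma gr_mul_symb (u : gr FU) (v : gr FV) k : gr_mul pair_op u v k =
  symb FW k (\sum_(i < k.+1) op (symb_repr (u i)) (symb_repr (v (k - i)%N))).
Proof.
rewrite symb_sum // => i; rewrite -[X in FW X](@subnKC i) -1?ltnS //.
by apply: (pair_mem pair_op); exact: symb_reprP.
Qed.

Lemma pair0l v : op 0 v = 0.
Proof. by rewrite -[0 in LHS](subrr 0) (pairBl pair_op) subrr. Qed.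

Lemma pair_suml v (I : Type) (r : seq I) (f : I -> U) :
  op (\sum_(i <- r) f i) v = \sum_(i <- r) op (f i) v.
Proof.
elim: r => [|i r IHr]; first by rewrite !big_nil pair0l.
by rewrite !big_cons (pairDl pair_op) IHr.
Qed.

Lemma pair0r u : op u 0 = 0.
Proof. by rewrite -[0 in LHS](subrr 0) (pairBr pair_op) subrr. Qed.

Lemma pair_sumr u (I : Type) (r : seq I) (f : I -> V) :
  op u (\sum_(i <- r) f i) = \sum_(i <- r) op u (f i).
Proof.
elim: r => [|i r IHr]; first by rewrite !big_nil pair0r.
by rewrite !big_cons (pairDr pair_op) IHr.
Qed.

End Pairing.

(** Through this, commutativity and associativity of the graded structures become congruences in [R]
    and [M]. *)
Lemma gr_homog_inj (M : zmodType) (F : filtration M) i x y :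
  F i x -> F i y -> gr_homog F i x = gr_homog F i y -> F i.+1 (x - y).
Proof.
move=> Fx Fy /(congr1 (fun u : gr F => u i)) /=.
by rewrite eqxx => /symb_eqP; apply.
Qed.

(** * Generation of gr(R) by finitely many elements of degree 1 *)

Section Ring.
Variables (R : naRingType) (F : ring_filtration R).
Hypothesis gr_comm : is_commutative (gr_ring F).

Let rp := ring_pairing F.

Lemma mulC_mod i j a b : F i a -> F j b -> F (i + j).+1 (a ** b - b ** a).
Proof.
move=> Fa Fb; have ji := addnC j i.
apply: gr_homog_inj (pair_mem rp Fa Fb) (pair_mem_eq rp ji Fb Fa) _.
rewrite -(gr_mul_homog rp erefl Fa Fb) -(gr_mul_homog rp ji Fb Fa).
exact: gr_comm.1.
Qed.

Lemma mulA_mod i j k a b c : F i a -> F j b -> F k c ->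
  F (i + j + k).+1 (a ** (b ** c) - a ** b ** c).
Proof.
move=> Fa Fb Fc; have Fab := pair_mem rp Fa Fb; have Fbc := pair_mem rp Fb Fc.
have ijk := addnA i j k.
apply: gr_homog_inj (pair_mem_eq rp ijk Fa Fbc) (pair_mem rp Fab Fc) _.
rewrite -(gr_mul_homog rp ijk Fa Fbc) -(gr_mul_homog rp erefl Fab Fc).
rewrite -(gr_mul_homog rp erefl Fa Fb) -(gr_mul_homog rp erefl Fb Fc).
exact: gr_comm.2.
Qed.

(* The [Q n], restricted to [F n], are the preimages of the components of a graded
   subalgebra of gr(R) that contains all of degree 0. *)
Lemma gr_generated_ind (S : set (gr_ring F)) (Q : nat -> set R) :
  generates_algebra (@gr_incl R F) S ->
  (forall n x y, F n.+1 (x - y) -> Q n y -> Q n x) ->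
  (forall n, Q n 0) ->
  (forall n x y, Q n x -> Q n y -> Q n (x - y)) ->
  Q 0%N = setT ->
  (forall i j k x y, (i + j)%N = k -> F i x -> F j y -> Q i x -> Q j y ->
    Q k (x ** y)) ->
  (forall u n, S u -> Q n (symb_repr (u n))) ->
  forall n x, F n x -> Q n x.
Proof.
move=> genS Qmod Q0 QB Q0T QM QS n x Fx.
pose B := [set u : gr_ring F | forall n, Q n (symb_repr (u n))].
(* On F^k(R), membership in [Q k] depends only on the symbol, so the choice made by [symb_repr] is
   immaterial. *)
have Qsymb k y z : F k z -> symb F k y = symb F k z -> F k y -> Q k z -> Q k y.
  by move=> Fz yz Fy; apply: Qmod; apply/symb_eqP.
have Bsub : is_subalgebra (@gr_incl R F) B.
  split.
  - split=> [k|u v Bu Bv k].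
      apply: (Qsymb _ _ 0); rewrite ?symb_reprK ?symb0 //; first exact: filt0.
      exact: symb_reprP.
    apply: (Qsymb _ _ (symb_repr (u k) - symb_repr (v k))) (QB _ _ _ (Bu k) (Bv k)).
    + by apply: filtB; exact: symb_reprP.
    + by rewrite symbB ?symb_reprK //; exact: symb_reprP.
    + exact: symb_reprP.
  - move=> c [|k]; first by rewrite Q0T.
    apply: (Qsymb _ _ 0); rewrite ?symb_reprK ?symb0 //; first exact: filt0.
    exact: symb_reprP.
  - move=> u v Bu Bv k.
    have ik (i : 'I_k.+1) : (i + (k - i))%N = k by rewrite subnKC // -ltnS.
    (* The degree-k component of the product is the symbol of a sum of products of representatives,
       each covered by [QM]. *)
    apply: Qsymb; [|rewrite symb_reprK; exact: (gr_mul_symb rp)|exact: symb_reprP|].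
      by apply: filt_sum => i _; apply: (pair_mem_eq rp (ik i)); exact: symb_reprP.
    elim/big_rec: _ => // i z _ Qz.
    rewrite -[z]opprK -[- z]sub0r; apply: (QB); last exact: QB.
    by apply: (QM _ _ _ _ _ (ik i)) => //; exact: symb_reprP.
have: B (gr_homog F n x).
  have : setT (gr_homog F n x) by [].
  by rewrite -genS; apply; split=> // u Su k; exact: QS.
move=> /(_ n); apply: Qsymb => //; first exact: symb_reprP.
by rewrite symb_reprK /= eqxx.
Qed.

(** For [x] in F^(n+1)(R) and [t] in F^1(R): the symbol of [x] lies in the sum of the gr(R)_n [t_i].
    The index [n] is that of the coefficients, one below the degree of [x]. *)
Definition lin_mod (I : finType) (t : I -> R) (n : nat) (x : R) :=
  exists2 a : I -> R, forall i, F n (a i) & F n.+2 (x - \sum_i a i ** t i).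

Section LinMod.
Variables (I : finType) (t : I -> R).
Hypothesis Ft : forall i, F 1%N (t i).

Lemma lin_mod_congr n x y : F n.+2 (x - y) -> lin_mod t n y -> lin_mod t n x.
Proof. by move=> xy [a Fa ya]; exists a => //; exact: filtB_trans ya. Qed.

Lemma lin_mod0 n : lin_mod t n 0.
Proof.
exists (fun=> 0) => [i|]; first exact: filt0.
by rewrite big1 ?subr0 => [|i _]; [exact: filt0 | rewrite (pair0l rp)].
Qed.

Lemma lin_modB n x y : lin_mod t n x -> lin_mod t n y -> lin_mod t n (x - y).
Proof.
move=> [a Fa xa] [b Fb yb]; exists (fun i => a i - b i) => [i|]; first exact: filtB.
under eq_bigr do rewrite (pairBl rp).
by rewrite sumrB opprD addrACA -opprD; exact: filtB.
Qed.

(** Reassociating x (a_j t_j) costs only an error in F^(i+n+2)(R). *)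
Lemma lin_mod_mull i n x y : F i x -> lin_mod t n y -> lin_mod t (i + n) (x ** y).
Proof.
move=> Fx [a Fa ya]; exists (fun j => x ** a j) => [j|]; first exact: (pair_mem rp).
apply: (@filtB_trans _ _ _ _ (\sum_j x ** (a j ** t j))).
  by rewrite -(pair_sumr rp) -(pairBr rp) -!addnS; exact: (pair_mem rp).
apply: filt_sumB => j.
by have := mulA_mod Fx (Fa j) (Ft j); rewrite addn1.
Qed.

Lemma lin_mod_mulr i n x y : F n.+1 y -> F i x -> lin_mod t n y ->
  lin_mod t (n + i) (y ** x).
Proof.
move=> Fy Fx ly; apply: (@lin_mod_congr (n + i) _ _ (mulC_mod Fy Fx)).
by rewrite addnC; exact: lin_mod_mull.
Qed.

End LinMod.

(** The degree-1 components of finitely many algebra generators span gr(R)_1 over gr(R)_0, as degree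
    1 splits only as 0+1 or 1+0. Generation in degree 1 then propagates this to every positive
    degree. *)
Lemma gr_deg1_generators (finS : finitely_generated_algebra (@gr_incl R F))
    (gen1 : generates_algebra (@gr_incl R F) (@gr_degree R F 1)) :
  exists (I : finType) (t : I -> R), (forall i, F 1%N (t i)) /\
    forall n x, F n.+1 x -> lin_mod t n x.
Proof.
have [S [/finite_seqP[s defS] genS]] := finS.
pose t (i : 'I_(size s)) := symb_repr ((nth 0 s i : gr_ring F) 1%N).
have Ft i : F 1%N (t i) by exact: symb_reprP.
exists 'I_(size s), t; split=> //.
have t1 x : F 1%N x -> lin_mod t 0 x.
  (* Only degree 1 is constrained, since the generators in [S] need not be homogeneous. *)
  pose Q n := if n is 1%N then lin_mod t 0 else setT.
  apply: (@gr_generated_ind S Q genS _ _ _ _ _ _ 1%N) => //.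
  - by move=> [|[|n]] y z //; exact: lin_mod_congr.
  - by move=> [|[|n]] //; exact: lin_mod0.
  - by move=> [|[|n]] y z //; exact: lin_modB.
  - move=> [|[|i]] [|[|j]] _ y z <- //= Fy Fz Qy Qz.
    + exact: (@lin_mod_mull _ t Ft 0 0).
    + exact: (@lin_mod_mulr _ t Ft 0 0).
  - move=> u [|[|n]] //= Su.
    have /(nthP 0)[i lt_i <-] : u \in s by move: Su; rewrite defS.
    exists (fun j : 'I_(size s) => if j == Ordinal lt_i then na_one else 0) => [j|].
      by rewrite filt_0.
    rewrite (bigD1 (Ordinal lt_i)) //= eqxx na_mul1r big1 ?addr0.
      by rewrite subrr; exact: filt0.
    by move=> j /negPf->; rewrite (pair0l rp).
move=> n x Fx; pose Q n := if n is m.+1 then lin_mod t m else setT.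
apply: (@gr_generated_ind _ Q gen1 _ _ _ _ _ _ n.+1) => //.
- by move=> [|k] y z //; exact: lin_mod_congr.
- by move=> [|k] //; exact: lin_mod0.
- by move=> [|k] y z //; exact: lin_modB.
(* The right factor carries the expansion unless it has degree 0; then the left one does, and
   commutativity modulo the next step is used. *)
- move=> i [|j] _ y z <- Fy Fz Qy Qz.
    by case: i Fy Qy => // i Fy Qy; exact: lin_mod_mulr.
  by rewrite addnS; exact: lin_mod_mull.
- move=> u [|[|k]] // Su; first by apply: t1; exact: symb_reprP.
  apply: (@lin_mod_congr _ t _ _ 0); last exact: lin_mod0.
  apply/symb_eqP; [exact: symb_reprP|exact: filt0|].
  by rewrite symb_reprK symb0; exact: Su.
Qed.

End Ring.

(** * Generators of gr(M) and successive approximation in [M] *)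

Section Space.
Variables (R : naRingType) (FR : ring_filtration R).
Variables (M : naSpaceType R) (FM : space_filtration FR M).
Hypothesis gr_mod : is_module (gr_space FM).

Let rp := ring_pairing FR.
Let sp := space_pairing FM.

Lemma scaleA_mod i j k a b x : FR i a -> FR j b -> FM k x ->
  FM (i + j + k).+1 (a **: (b **: x) - a ** b **: x).
Proof.
move=> Fa Fb Fx; have Fab := pair_mem rp Fa Fb; have Fbx := pair_mem sp Fb Fx.
have ijk := addnA i j k.
apply: gr_homog_inj (pair_mem_eq sp ijk Fa Fbx) (pair_mem sp Fab Fx) _.
rewrite -(gr_mul_homog sp ijk Fa Fbx) -(gr_mul_homog sp erefl Fab Fx).
rewrite -(gr_mul_homog rp erefl Fa Fb) -(gr_mul_homog sp erefl Fb Fx).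
exact/esym/gr_mod.
Qed.

Lemma gr_component_generators : finitely_generated (gr_space FM) ->
  exists (I : finType) (e : I -> nat) (x : I -> M) (D : nat),
  [/\ forall i, (e i <= D)%N, forall i, FM (e i) (x i) &
    forall k m, (D <= k)%N -> FM k m -> exists2 a : I -> R,
      forall i, FR (k - e i)%N (a i) & FM k.+1 (m - \sum_i a i **: x i)].
Proof.
move=> [n [g gP]].
have [N gN] : exists N, forall i k, (N <= k)%N -> g i k = 0.
  have [N hN] := choice (fun i => dsum_fin (g i)).
  exists (\max_i N i) => i k le_k; apply: hN; apply: leq_trans le_k.
  exact: leq_bigmax.
(* The homogeneous generators are all components of the [g i] in degrees up to [N], zero components
   included. *)
exists ('I_n * 'I_N.+1)%type, (fun p : 'I_n * 'I_N.+1 => nat_of_ord p.2),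
  (fun p : 'I_n * 'I_N.+1 => symb_repr (g p.1 p.2)), N.
split=> [[i e]|[i e]|k m le_Nk Fm] /=; first by rewrite -ltnS.
  exact: symb_reprP.
have [a am] := gP (gr_homog FM k m).
exists (fun p : 'I_n * 'I_N.+1 => symb_repr (a p.1 (k - p.2)%N)) => [p|]; first exact: symb_reprP.
have Fk i (e : 'I_N.+1) : FM k (symb_repr (a i (k - e)%N) **: symb_repr (g i e)).
  have le_ek : (e <= k)%N by apply: leq_trans le_Nk; rewrite -ltnS.
  by apply: (pair_mem_eq sp (subnK le_ek)); exact: symb_reprP.
apply/symb_eqP => //; first by apply: filt_sum => -[i e] _; exact: Fk.
have -> : symb FM k m = (gr_homog FM k m : gr FM) k by rewrite /= eqxx.
rewrite am.
have -> : (\sum_i a i **: g i : gr FM) k = \sum_i (gr_mul sp (a i) (g i) : gr FM) k.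
  elim/big_ind2: _ => // u u' v v'; move=> <- <-; exact: dsumDE.
rewrite symb_sum => [|[i e]]; last exact: Fk.
rewrite -(pair_bigA _ (fun i (e : 'I_N.+1) => gr_comp_mul FM (@na_scale R M) k (a i (k - e)%N) (g i e))) /=.
(* The graded product is summed over the degree of the ring factor; reversal indexes it by the
   degree of the space factor. Degrees above [N] then contribute zero. *)
apply: eq_bigr => i _; rewrite (reindex_inj rev_ord_inj) /=.
rewrite (big_ord_widen k.+1 (fun e => gr_comp_mul FM (@na_scale R M) k
  (a i (k - e)%N) (g i e))) // [RHS]big_mkcond; apply: eq_bigr => e _ /=.
have le_ek : (e <= k)%N by rewrite -ltnS.
rewrite subSS subKn //; case: ltnP => // /ltnW/gN ->.
by rewrite (gr_comp_mul0r sp (subnK le_ek)).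
Qed.

(** The [y j] are the iterated products t_(i1) (t_(i2) (... x)) with m factors, chosen before [n].
    In the induction each coefficient in F^(n+1)(R) is expanded along [t], then reassociated. *)
Lemma lead_generators_shift (I : finType) (t : I -> R) :
  (forall i, FR 1%N (t i)) -> (forall n x, FR n.+1 x -> lin_mod FR t n x) ->
  forall m e x, FM e x -> exists (J : finType) (y : J -> M),
  (forall j, FM (m + e)%N (y j)) /\
  forall n r, FR (n + m)%N r -> exists2 a : J -> R, forall j, FR n (a j) &
    FM (n + m + e).+1 (r **: x - \sum_j a j **: y j).
Proof.
move=> Ft tP m e x Fx; elim: m => [|m [J [y [Fy yP]]]].
  exists unit, (fun=> x); split=> // n r Fr; exists (fun=> r) => [_|].
    by rewrite addn0 in Fr.
  by rewrite big_const card_unit /= addr0 subrr; exact: filt0.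
exists (I * J)%type, (fun p => t p.1 **: y p.2).
split=> [[i j]|n r Fr] /=; first by rewrite addSn; exact: (pair_mem sp (Ft i)).
have nm : (n + m.+1)%N = (n.+1 + m)%N by rewrite addnS addSn.
rewrite nm in Fr *; have [a Fa ar] := yP _ _ Fr.
have /choice[b bP] j : exists b : I -> R, (forall i, FR n (b i)) /\
    FR n.+2 (a j - \sum_i b i ** t i).
  by have [b] := tP _ _ (Fa j); exists b.
exists (fun p => b p.2 p.1) => [[i j]|]; first exact: (bP j).1.
apply: filtB_trans ar _.
rewrite -(pair_bigA _ (fun i j => b j i **: (t i **: y j))) exchange_big /=.
apply: filt_sumB => j; apply: (@filtB_trans _ _ _ _ ((\sum_i b j i ** t i) **: y j)).
  rewrite -(pairBl sp); apply: (pair_mem_eq sp _ (bP j).2 (Fy j)).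
  by rewrite addnA.
rewrite (pair_suml sp); apply: filt_sumB => i.
by apply: filtBC; rewrite -addnA -[n.+1]addn1; exact: scaleA_mod ((bP j).1 i) (Ft i) (Fy j).
Qed.

Lemma series_expansion (J : finType) (y : J -> M) d :
  complete FR -> separated FM ->
  (forall j, FM d (y j)) ->
  (forall n m, FM (n + d)%N m -> exists2 a : J -> R,
    forall j, FR n (a j) & FM (n + d).+1 (m - \sum_j a j **: y j)) ->
  forall n m, FM (n + d)%N m -> exists2 a : J -> R,
    forall j, FR n (a j) & m = \sum_j a j **: y j.
Proof.
move=> FRc FMs Fy yP n m Fm.
(* The choice of coefficients is made total: they are 0 when [p.2] lies outside F^(p.1+d)(M). *)
have /choice[f fP] (p : nat * M) : exists a : J -> R, FM (p.1 + d)%N p.2 ->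
    (forall j, FR p.1 (a j)) /\ FM (p.1 + d).+1 (p.2 - \sum_j a j **: y j).
  case: p => k z /=; have [Fz|nFz] := pselect (FM (k + d)%N z).
    by have [a] := yP _ _ Fz; exists a.
  by exists (fun=> 0).
(* [rem k] is what is left of [m] after k corrections, the l-th having coefficients in
   F^(n+l)(R). *)
pose rem := fix rem k := if k is l.+1 then
  rem l - \sum_j f (n + l, rem l)%N j **: y j else m.
have Frem k : FM (n + k + d)%N (rem k).
  elim: k => [|k /(fP (_, _))[_] /=]; first by rewrite addn0.
  by rewrite addnS addSn.
have Ff k j : FR (n + k)%N (f (n + k, rem k)%N j) by exact: (fP (_, _) (Frem k)).1.
have /choice[a aP] j : exists a, forall k,
    FR (n + k)%N (a - \sum_(l < k) f (n + l, rem l)%N j).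
  exact: (@complete_series _ _ n (fun l => f (n + l, rem l)%N j) FRc).
exists a => [j|]; first by have := aP j 0%N; rewrite big_ord0 subr0 addn0.
have remE k : rem k = m - \sum_j (\sum_(l < k) f (n + l, rem l)%N j) **: y j.
  elim: k => [|k IHk].
    by rewrite big1 ?subr0 // => j _; rewrite big_ord0 (pair0l sp).
  rewrite /= {1}IHk -addrA -opprD -big_split /=; congr (_ - _).
  by apply: eq_bigr => j _; rewrite big_ord_recr /= (pairDl sp).
apply/eqP; rewrite -subr_eq0; apply/eqP.
suff: (\bigcap_k FM k) (m - \sum_j a j **: y j) by rewrite FMs.
(* The difference is [rem k] plus the effect of truncating the series for the [a j]; both lie in
   F^(n+k+d)(M). *)
move=> k _; apply: (@filt_le _ _ k (n + k + d)%N); first by rewrite -addnA addnCA leq_addr.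
apply: (@filtB_trans _ _ _ _ (\sum_j (\sum_(l < k) f (n + l, rem l)%N j) **: y j)).
  by rewrite -remE.
apply: filt_sumB => j; rewrite -(pairBl sp).
by apply: (pair_mem sp) => //; exact: filtBC.
Qed.

End Space.

Theorem theorem4p7 (R : naRingType) (FR : ring_filtration R)
    (M : naSpaceType R) (FM : space_filtration FR M) :
  complete_local_filtered FR ->
  separated FM ->
  is_module (gr_space FM) ->
  finitely_generated (gr_space FM) ->
  exists D : nat, forall n d : nat, (D <= d)%N ->
    FM (n + d)%N = add_prod na_scale (FR n) (FM d).
Proof.
move=> [FRc _ gr_comm finS gen1] FMs gr_mod gr_fg.
have [I [t [Ft tP]]] := gr_deg1_generators gr_comm finS gen1.
have [K [e [x [D [eD Fx xP]]]]] := gr_component_generators gr_fg.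
exists D => n d le_Dd; apply/seteqP; split; last exact: sfilt_scale.
(* Each generator [x i], of degree e_i, is shifted by d - e_i to reach degree exactly d. *)
have /choice[J JP] i : exists J : finType, exists y : J -> M,
    (forall j, FM d (y j)) /\
    forall n r, FR (n + (d - e i))%N r -> exists2 a : J -> R, forall j, FR n (a j) &
      FM (n + d).+1 (r **: x i - \sum_j a j **: y j).
  have le_ed : (e i <= d)%N := leq_trans (eD i) le_Dd.
  have [J [y [Fy yP]]] := lead_generators_shift gr_mod Ft tP (d - e i) (Fx i).
  exists J, y; split=> [j|k r Fr]; first by rewrite -(subnK le_ed).
  by have := yP k r Fr; rewrite -addnA subnK.
have [y yP] : exists y : forall i, J i -> M, forall i,
    (forall j, FM d (y i j)) /\
    forall n r, FR (n + (d - e i))%N r -> exists2 a : J i -> R, forall j, FR n (a j) &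
      FM (n + d).+1 (r **: x i - \sum_j a j **: y i j).
  by exists (fun i => sval (cid (JP i))) => i; exact: svalP (cid (JP i)).
(* The index type [J i] varies with [i], so the families are merged over dependent pairs. *)
pose z (p : {i : K & J i}) := y (tag p) (tagged p).
have Fz p : FM d (z p) by exact: (yP (tag p)).1.
move=> m Fm.
have [b Fb mE] : exists2 b : {i : K & J i} -> R, forall p, FR n (b p) & m = \sum_p b p **: z p.
  apply: (series_expansion FRc FMs Fz) Fm => k w Fw.
  have [a Fa wa] := xP _ _ (leq_trans le_Dd (leq_addl k d)) Fw.
  have [b bP] : exists b : forall i, J i -> R, forall i, (forall j, FR k (b i j)) /\
      FM (k + d).+1 (a i **: x i - \sum_j b i j **: y i j).
    have bP i : exists b : J i -> R, (forall j, FR k (b j)) /\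
      FM (k + d).+1 (a i **: x i - \sum_j b j **: y i j).
      (* As e_i <= d, the level k + d - e_i of the coefficient is k + (d - e_i), as [yP] expects. *)
      have := Fa i; rewrite -addnBA ?(leq_trans (eD i)) // => /(yP i).2[b].
      by exists b.
    by exists (fun i => sval (cid (bP i))) => i; exact: svalP (cid (bP i)).
  exists (fun p => b (tag p) (tagged p)) => [p|]; first exact: (bP (tag p)).1.
  apply: filtB_trans wa _.
  rewrite -(@sig_big_dep _ _ _ _ _ xpredT (fun=> xpredT) (fun i j => b i j **: y i j)) /=.
  by apply: filt_sumB => i; exact: (bP i).2.
exists #|{: {i : K & J i}}|, (b \o enum_val), (z \o enum_val); split=> [i|i|] /=.
- exact: Fb.
- exact: Fz.
- by rewrite mE -(big_enum_val (fun p => b p **: z p)).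
Qed.
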